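(* Suppose the algorithm $\mathrm{GraphBoost}$ described in the context is applied with $T\asymp\log n$ an odd integer. Suppose $\widetilde\theta$ is an $(\epsilon,\delta)$-node DP algorithm satisfying $$\mathbb P\left(\widetilde{\mathcal L}(\widetilde\theta(A),\theta)>\xi\right)\le0.2$$ for some $\xi<\frac{1}{8k}$, when $A\sim SBM(n,k,\frac BT,\theta)$. Then the output $\hat\theta$ of $\mathrm{GraphBoost}$ satisfies $(\epsilon T,\delta T)$-node DP and $$\mathbb P\left(\widetilde{\mathcal L}(\hat\theta(G),\theta)>\xi T\right)\le\frac{c}{\log n}$$ when $G\sim SBM(n,k,B,\theta)$, for an absolute constant $c>0$.
   Context: $f\asymp g$ means $c_1g(n)\le f(n)\le c_2g(n)$ for all sufficiently large $n$, with constants $c_1,c_2\in(0,\infty)$; statements are for sufficiently large $n$. $\mathcal G_n$ is the set of unweighted undirected graphs on $[n]$, identified with adjacency matrices. $d_{node}(G,G')$ is the minimum number of nodes that must be rewired (row/column of the adjacency matrix changed) to turn $G'$ into $G$; $G\sim_{node}G'$ if $d_{node}(G,G')\le1$. A randomized algorithm $\mathcal A$ is $(\epsilon,\delta)$-node DP if $\mathbb P(\mathcal A(G)\in S)\le e^\epsilon\mathbb P(\mathcal A(G')\in S)+\delta$ for all $G\sim_{node}G'$ in $\mathcal G_n$ and measurable $S$. Stochastic block model: $\theta\in[k]^n$ is balanced, $|\{i:\theta_i=j\}|=n/k$ for all $j$. $B\in(0,1]^{k\times k}$ is symmetric and invertible. $A\sim SBM(n,k,B,\theta)$ has independent $A_{ij}\sim\mathrm{Ber}(B_{\theta_i,\theta_j})$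 for $i<j$, $A_{ji}=A_{ij}$, zero diagonal. Losses: with $C_j=\{i:\theta_i=j\}$ and $S_k$ the permutation group of $[k]$, $\widetilde{\mathcal L}(\hat\theta,\theta)=\min_{\sigma\in S_k}\max_{j\in[k]}\frac{2}{|C_j|}\sum_{i\in C_j}\mathbf 1\{\sigma(\hat\theta_i)\ne j\}$ and $\mathcal L(\hat\theta,\theta)=\min_{\sigma\in S_k}\frac2n\sum_{i=1}^n\mathbf 1\{\sigma(\hat\theta_i)\ne\theta_i\}$. Algorithm $\mathrm{GraphBoost}$ (inputs: odd $T$, $\xi$, graph $G$, $\epsilon,\delta$, $k$, mechanism $\widetilde\theta$). One-hot encodings are $n\times k$ matrices with exactly one $1$ per row; $E_k$ is the set of $k\times k$ permutation matrices; $\|\cdot\|_0$ counts nonzero entries. (1) Construct subgraphs $G_1,\dots,G_T$ of $G$: independently for each $j$, keep each edge of $G$ independently with probability $1/T$. (2) Compute $\widetilde\theta(G_1),\dots,\widetilde\theta(G_T)$ (with independent internal randomness), with one-hot encodings $\widetilde\Theta_1,\dots,\widetilde\Theta_T$. (3) Select $j^*\in[T]$ with $\sum_{j=1}^T\mathbf 1\{\mathcal L(\widetilde\theta(G_{j^*}),\widetilde\theta(G_j))\le2\xi\}\ge\frac{T+1}{2}$ (output $\perp$ if none exists; choose at random if several). (4) For each $j$ let $J_j\in\arg\min_{J\in E_k}\|\widetilde\Theta_jJ-\widetilde\Theta_{j^*}\|_0$. (5) Let each row of $\hat\Theta$ be the majority vote among the corresponding rows of $\{\widetilde\Theta_jJ_j\}_{j=1}^T$;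 return the corresponding assignment $\hat\theta(G)$. *)

(* Defs.v *)
From HB Require Import structures.
From mathcomp Require Import all_boot all_order all_algebra.
From mathcomp Require Import fingroup perm reals sequences exp.

Set Implicit Arguments.
Unset Strict Implicit.
Unset Printing Implicit Defensive.

Import Order.TTheory GRing.Theory Num.Theory.

Local Open Scope ring_scope.

(* Every random object below takes finitely many values, so laws are finite
   mass functions, a randomized algorithm is a map into them, and every set of
   outputs is measurable. *)

Section Dist.
Variable R : realType.

Record dist (X : finType) := Dist {
  pmf :> X -> R;
  pmf_ge0 : forall x, 0 <= pmf x;
  pmf_sum1 : \sum_x pmf x = 1 }.

Definition pr (X : finType) (mu : dist X) (S : {set X}) : R :=
  \sum_(x in S) mu x.

Section Ret.
Variables (X : finType) (x0 : X).
Definition ret_pmf (x : X) : R := (x == x0)%:R.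
Lemma ret_pmf_ge0 x : 0 <= ret_pmf x. Proof. exact: ler0n. Qed.
Lemma ret_pmf_sum1 : \sum_x ret_pmf x = 1.
Proof.
rewrite (bigD1 x0) //= /ret_pmf eqxx big1 ?addr0 // => x /negPf -> //.
Qed.
Definition dret := Dist ret_pmf_ge0 ret_pmf_sum1.
End Ret.

Section Bind.
Variables (X Y : finType) (mu : dist X) (f : X -> dist Y).
Definition bind_pmf (y : Y) : R := \sum_x mu x * f x y.
Lemma bind_pmf_ge0 y : 0 <= bind_pmf y.
Proof. by apply: sumr_ge0 => x _; rewrite mulr_ge0 ?pmf_ge0. Qed.
Lemma bind_pmf_sum1 : \sum_y bind_pmf y = 1.
Proof.
rewrite exchange_big /= -[RHS](pmf_sum1 mu); apply: eq_bigr => x _.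
by rewrite -mulr_sumr pmf_sum1 mulr1.
Qed.
Definition dbind := Dist bind_pmf_ge0 bind_pmf_sum1.
End Bind.

Definition dmap (X Y : finType) (f : X -> Y) (mu : dist X) : dist Y :=
  dbind mu (fun x => dret (f x)).

(* The law of an independent family whose i-th member has law mu i. *)
Section Prod.
Variables (I X : finType) (mu : I -> dist X).
Definition prod_pmf (w : {ffun I -> X}) : R := \prod_i mu i (w i).
Lemma prod_pmf_ge0 w : 0 <= prod_pmf w.
Proof. by apply: prodr_ge0 => i _; exact: pmf_ge0. Qed.
Lemma prod_pmf_sum1 : \sum_w prod_pmf w = 1.
Proof.
rewrite -(bigA_distr_bigA (fun i x => mu i x)) /=.
by apply: big1 => i _; exact: pmf_sum1.
Qed.
Definition dprod := Dist prod_pmf_ge0 prod_pmf_sum1.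
End Prod.

(* Ber(p).  The parameter is clipped to [0, 1] only to make this total. *)
Section Bernoulli.
Variable p : R.
Definition bern_pmf (b : bool) : R :=
  let q := Num.max 0 (Num.min 1 p) in if b then q else 1 - q.
Lemma bern_pmf_ge0 b : 0 <= bern_pmf b.
Proof.
case: b; rewrite /bern_pmf; first by rewrite le_max lexx.
by rewrite subr_ge0 ge_max ler01 ge_min lexx.
Qed.
Lemma bern_pmf_sum1 : \sum_b bern_pmf b = 1.
Proof. by rewrite big_bool /= addrC subrK. Qed.
Definition dbern := Dist bern_pmf_ge0 bern_pmf_sum1.
End Bernoulli.

(* A uniformly random element of A, or None if A is empty. *)
Section Select.
Variables (X : finType) (A : {set X}).
Definition select_pmf (o : option X) : R :=
  if o is Some x then (x \in A)%:R / #|A|%:R else (A == set0)%:R.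
Lemma select_pmf_ge0 o : 0 <= select_pmf o.
Proof. by case: o => [x|] /=; rewrite ?divr_ge0 ?ler0n. Qed.
Lemma select_pmf_sum1 : \sum_o select_pmf o = 1.
Proof.
rewrite (bigD1 None) //= (reindex_omap Some id) => [|[x|]] //=.
under eq_bigl do rewrite eqxx.
rewrite -mulr_suml -natr_sum -big_mkcond /= sum1_card.
have [->|An0] := eqVneq A set0; first by rewrite cards0 mul0r addr0.
by rewrite add0r divff // pnatr_eq0 cards_eq0.
Qed.
Definition dselect := Dist select_pmf_ge0 select_pmf_sum1.
End Select.

End Dist.

Definition asymp (R : realType) (f g : nat -> R) : Prop :=
  exists c1 c2 : R, [/\ 0 < c1, 0 < c2 &
    exists N : nat, forall n : nat, (N <= n)%N ->
      c1 * g n <= f n /\ f n <= c2 * g n].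

Definition is_adjacency n (A : 'M[bool]_n) : bool :=
  [forall i, ~~ A i i] && [forall i, forall j, A i j == A j i].

Notation graph n := {A : 'M[bool]_n | is_adjacency A}.

Definition adj n (G : graph n) (i j : 'I_n) : bool := val G i j.

Definition upper_mx n (w : {ffun 'I_n * 'I_n -> bool}) : 'M[bool]_n :=
  \matrix_(i, j) (if (i < j)%N then w (i, j)
                  else if (j < i)%N then w (j, i) else false).

Lemma upper_mxP n (w : {ffun 'I_n * 'I_n -> bool}) : is_adjacency (upper_mx w).
Proof.
apply/andP; split; first by apply/forallP => i; rewrite mxE ltnn.
by apply/forallP => i; apply/forallP => j; rewrite !mxE; case: ltngtP.
Qed.

(* The graph whose edges {i, j}, i < j, are those with w (i, j) = true; the
   values w (i, j) with j <= i are ignored. *)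
Definition graph_of n (w : {ffun 'I_n * 'I_n -> bool}) : graph n :=
  exist _ (upper_mx w) (upper_mxP w).

(* Rewiring the nodes of S turns G' into G iff the adjacency matrices agree
   off the rows and columns indexed by S. *)
Definition rewires n (S : {set 'I_n}) (G G' : graph n) : bool :=
  [forall i, forall j,
     (i \notin S) && (j \notin S) ==> (adj G i j == adj G' i j)].

(* S = [set: 'I_n] always qualifies, so the neutral value n is harmless. *)
Definition d_node n (G G' : graph n) : nat :=
  \big[minn/n]_(S : {set 'I_n} | rewires S G G') #|S|.

Definition node_adjacent n (G G' : graph n) : bool := (d_node G G' <= 1)%N.

Definition node_DP (R : realType) n (O : finType) (eps delta : R)
    (alg : graph n -> dist R O) : Prop :=
  forall G G' : graph n, node_adjacent G G' ->
  forall S : {set O}, pr (alg G) S <= expR eps * pr (alg G') S + delta.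

Notation labeling n k := {ffun 'I_n -> 'I_k}.

Definition cluster n k (theta : labeling n k) (j : 'I_k) : {set 'I_n} :=
  [set i | theta i == j].

Definition balanced n k (theta : labeling n k) : Prop :=
  forall j : 'I_k, (#|cluster theta j| * k)%N = n.

Definition connectivity (R : realType) k (B : 'M[R]_k) : Prop :=
  [/\ forall i j, 0 < B i j <= 1, B^T = B & B \in unitmx].

Definition SBM (R : realType) n k (B : 'M[R]_k) (theta : labeling n k) :
    dist R (graph n) :=
  dmap (@graph_of n)
    (dprod (fun e : 'I_n * 'I_n => dbern (B (theta e.1) (theta e.2)))).

(* In both losses the minimum over S_k is folded starting from the value at
   the identity permutation; the inner maximum is of nonnegative numbers. *)
Definition worst_loss (R : realType) n k (that theta : labeling n k) : R :=
  let err (s : 'S_k) : R :=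
    \big[Num.max/0]_(j < k)
      (2 / #|cluster theta j|%:R *
       \sum_(i in cluster theta j) (s (that i) != j)%:R) in
  \big[Num.min/err 1%g]_(s : 'S_k) err s.

Definition avg_loss (R : realType) n k (that theta : labeling n k) : R :=
  let err (s : 'S_k) : R :=
    2 / n%:R * \sum_(i < n) (s (that i) != theta i)%:R in
  \big[Num.min/err 1%g]_(s : 'S_k) err s.

Definition onehot n k (theta : labeling n k) : 'M[int]_(n, k) :=
  \matrix_(i, c) (theta i == c)%:R.

Definition norm0 m n (M : 'M[int]_(m, n)) : nat :=
  #|[set e : 'I_m * 'I_n | M e.1 e.2 != 0]|.

Section GraphBoost.
Variables (R : realType) (n k T : nat).

Definition subsample (G : graph n) : dist R (graph n) :=
  dmap (fun w : {ffun 'I_n * 'I_n -> bool} =>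
          graph_of [ffun e => adj G e.1 e.2 && w e])
       (dprod (fun=> dbern T%:R^-1)).

Definition candidates (xi : R) (th : {ffun 'I_T -> labeling n k}) :
    {set 'I_T} :=
  [set j0 | (T%:R + 1) / 2 <=
            \sum_(j < T) (avg_loss R (th j0) (th j) <= 2 * xi)%R%:R :> R].

Definition aligned (th : {ffun 'I_T -> labeling n k})
    (J : {ffun 'I_T -> 'S_k}) (j : 'I_T) : 'M[int]_(n, k) :=
  onehot (th j) *m perm_mx (J j).

Definition alignment_rule :=
  {ffun 'I_T -> labeling n k} -> 'I_T -> dist R {ffun 'I_T -> 'S_k}.

(* The argmin over permutation matrices need not be unique: a rule is any,
   possibly randomized, way of choosing minimizers. *)
Definition valid_alignment (align : alignment_rule) : Prop :=
  forall th jstar J, align th jstar J != 0 ->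
  forall (j : 'I_T) (s : 'S_k),
    (norm0 (aligned th J j - onehot (th jstar)) <=
     norm0 (onehot (th j) *m perm_mx s - onehot (th jstar)))%N.

Definition vote_rule :=
  {ffun 'I_T -> labeling n k} -> {ffun 'I_T -> 'S_k} -> dist R (labeling n k).

(* Each row of the result is a most frequent one among the T aligned rows,
   ties being broken in any, possibly randomized, way. *)
Definition valid_vote (vote : vote_rule) : Prop :=
  forall th J l, vote th J l != 0 ->
  forall (i : 'I_n) (v : 'rV[int]_k),
    (#|[set j | row i (aligned th J j) == v]| <=
     #|[set j | row i (aligned th J j) == row i (onehot l)]|)%N.

(* None encodes the failure output. *)
Definition graph_boost (xi : R) (align : alignment_rule) (vote : vote_rule)
    (mech : graph n -> dist R (labeling n k)) (G : graph n) :
    dist R (option (labeling n k)) :=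
  dbind (dprod (fun _ : 'I_T => subsample G)) (fun Gs =>
  dbind (dprod (fun j : 'I_T => mech (Gs j))) (fun th =>
  dbind (dselect R (candidates xi th)) (fun o =>
  if o is Some jstar then
    dbind (align th jstar) (fun J => dmap Some (vote th J))
  else dret R None))).

End GraphBoost.

(* Main.v *)
Require Import Defs.
From mathcomp Require Import all_boot all_order all_algebra.
From mathcomp Require Import fingroup perm reals sequences exp.
From mathcomp Require Import zify ring lra.

(** Privacy holds because the output depends on the input graph only through
    the [T] preliminary labelings, which are independent given the graph.
    Subsampling preserves node privacy, since two adjacent graphs can be
    subsampled with the same edge mask ([node_DP_subsample]); composing [T]
    guarantees multiplies [eps] and [delta] by [T]
    ([dprod_indistinguishable]); the rest is post-processing.

    Utility has a deterministic and a probabilistic half.  Call a run good if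
    its worst-cluster loss is at most [xi].  If more than half of the runs are
    good, then the algorithm returns a labeling of loss at most [xi * T]
    whatever else happens ([candidates_neq0], [vote_worst_loss]).  Good runs are
    within [2 * xi] of one another, so a run is selected; any selected run is
    close to a majority of the runs, hence to a good one.  As [xi < 1 / (8 k)],
    the alignment step then relabels the good runs consistently, and a node can
    lose the vote only if some good run is wrong on it, so the errors of the
    vote are at most the sum of the errors of at most [T] good runs.

    It remains to show that at least half of the runs fail only with small
    probability ([half_runs_fail]).  The subsampled graphs share the randomness
    of the input graph [G], so the runs are not independent; they are
    independent given [G], each failing with a probability [p G] whose mean is
    at most [1/5].  What is needed is that [p G] concentrates.  The key is a
    coupling, edge by edge, of [G] with [T] mutually independent graphs
    [H_1 .. H_T] such that each pair [(G, H_c)] is distributed as [G] with one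
    of its subsamples ([splitting]).  Given [G], the average of the failure
    probabilities on the [H_c] has mean [p G], so by Jensen's inequality the
    exponential moments of [T * p G] are at most those of a sum of [T]
    independent variables of mean at most [1/5] ([expR_thinning_mean]).
    Markov's inequality for [(3/2) ^ N], with [N] the number of failures, then
    gives the bound [(24/25) ^ (T/2)].  Decay faster than [1 / T] is essential:
    the constant [c] may not depend on the ratio of [T] to [ln n], and a
    geometric bound allows [c = 1] ([geometric_le_inv_ln]). *)

Set Implicit Arguments.
Unset Strict Implicit.
Unset Printing Implicit Defensive.

Import Order.TTheory GRing.Theory Num.Theory.

Local Open Scope ring_scope.

(** * Expectations *)

Section Expectation.
Variable R : realType.

Definition expect (X : finType) (mu : dist R X) (F : X -> R) : R :=
  \sum_x mu x * F x.

Lemma pr_expect (X : finType) (mu : dist R X) (S : {set X}) :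
  pr mu S = expect mu (fun x => (x \in S)%:R).
Proof.
rewrite /pr /expect big_mkcond; apply: eq_bigr => x _.
by case: ifP; rewrite ?mulr1 ?mulr0.
Qed.

Lemma eq_expect (X : finType) (mu : dist R X) (F G : X -> R) :
  F =1 G -> expect mu F = expect mu G.
Proof. by move=> FG; apply: eq_bigr => x _; rewrite FG. Qed.

Lemma eq_expect_pmf (X : finType) (mu nu : dist R X) (F : X -> R) :
  mu =1 nu -> expect mu F = expect nu F.
Proof. by move=> mn; apply: eq_bigr => x _; rewrite mn. Qed.

Lemma le_expect_supp (X : finType) (mu : dist R X) (F G : X -> R) :
  (forall x, mu x != 0 -> F x <= G x) -> expect mu F <= expect mu G.
Proof.
move=> FG; apply: ler_sum => x _.
have [->|mu0] := eqVneq (mu x) 0; first by rewrite !mul0r.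
by rewrite ler_wpM2l ?pmf_ge0 ?FG.
Qed.

Lemma le_expect (X : finType) (mu : dist R X) (F G : X -> R) :
  (forall x, F x <= G x) -> expect mu F <= expect mu G.
Proof. by move=> FG; apply: le_expect_supp => x _. Qed.

Lemma expect_cst (X : finType) (mu : dist R X) c : expect mu (fun=> c) = c.
Proof. by rewrite /expect -mulr_suml pmf_sum1 mul1r. Qed.

Lemma expectD (X : finType) (mu : dist R X) (F G : X -> R) :
  expect mu (fun x => F x + G x) = expect mu F + expect mu G.
Proof. by rewrite -big_split; apply: eq_bigr => x _; rewrite mulrDr. Qed.

Lemma expectZ (X : finType) (mu : dist R X) c (F : X -> R) :
  expect mu (fun x => c * F x) = c * expect mu F.
Proof. by rewrite mulr_sumr; apply: eq_bigr => x _; rewrite mulrCA. Qed.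

Lemma expect_sum (X I : finType) (mu : dist R X) (F : I -> X -> R) :
  expect mu (fun x => \sum_i F i x) = \sum_i expect mu (F i).
Proof.
by rewrite exchange_big; apply: eq_bigr => x _; rewrite mulr_sumr.
Qed.

Lemma expect_ge0 (X : finType) (mu : dist R X) (F : X -> R) :
  (forall x, 0 <= F x) -> 0 <= expect mu F.
Proof. by move=> F0; rewrite -(expect_cst mu 0); apply: le_expect. Qed.

Lemma expect_le1 (X : finType) (mu : dist R X) (F : X -> R) :
  (forall x, F x <= 1) -> expect mu F <= 1.
Proof. by move=> F1; rewrite -(expect_cst mu 1); apply: le_expect. Qed.

Lemma pr_ge0 (X : finType) (mu : dist R X) (S : {set X}) : 0 <= pr mu S.
Proof. by rewrite pr_expect; apply: expect_ge0 => x; exact: ler0n. Qed.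

Lemma pr_le1 (X : finType) (mu : dist R X) (S : {set X}) : pr mu S <= 1.
Proof. by rewrite pr_expect; apply: expect_le1 => x; rewrite lern1 leq_b1. Qed.

Lemma expect_bind (X Y : finType) (mu : dist R X) (f : X -> dist R Y) F :
  expect (dbind mu f) F = expect mu (fun x => expect (f x) F).
Proof.
rewrite /expect; under eq_bigr => y _ do rewrite /= /bind_pmf mulr_suml.
rewrite exchange_big; apply: eq_bigr => x _; rewrite mulr_sumr.
by apply: eq_bigr => y _; rewrite mulrA.
Qed.

Lemma expect_ret (X : finType) (x : X) (F : X -> R) : expect (dret R x) F = F x.
Proof.
rewrite /expect (bigD1 x) //= /ret_pmf eqxx mul1r big1 ?addr0 // => y.
by move=> /negPf->; rewrite mul0r.
Qed.

Lemma expect_map (X Y : finType) (mu : dist R X) (f : X -> Y) F :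
  expect (dmap f mu) F = expect mu (F \o f).
Proof. by rewrite expect_bind; apply: eq_expect => x; rewrite expect_ret. Qed.

Lemma pr_bind (X Y : finType) (mu : dist R X) (f : X -> dist R Y) S :
  pr (dbind mu f) S = expect mu (fun x => pr (f x) S).
Proof.
by rewrite pr_expect expect_bind; apply: eq_expect => x; rewrite -pr_expect.
Qed.

Lemma expect_prod (I X : finType) (mu : I -> dist R X) (F : I -> X -> R) :
  expect (dprod mu) (fun w => \prod_i F i (w i)) = \prod_i expect (mu i) (F i).
Proof.
rewrite /expect bigA_distr_bigA; apply: eq_bigr => w _.
by rewrite big_split.
Qed.

Lemma eq_dprod (I X : finType) (mu nu : I -> dist R X) :
  (forall i, mu i =1 nu i) -> dprod mu =1 dprod nu.
Proof. by move=> mn w; apply: eq_bigr => i _; rewrite mn. Qed.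

(** Independence is preserved when each coordinate is resampled from a law
    that depends on that coordinate only. *)
Lemma expect_dprod_bind (I X Y : finType) (mu : I -> dist R X)
    (f : I -> X -> dist R Y) (F : {ffun I -> Y} -> R) :
  expect (dprod mu) (fun w => expect (dprod (fun i => f i (w i))) F) =
  expect (dprod (fun i => dbind (mu i) (f i))) F.
Proof.
rewrite -expect_bind; apply: eq_expect_pmf => y /=.
rewrite /bind_pmf /= /prod_pmf /= /bind_pmf bigA_distr_bigA /=.
by apply: eq_bigr => w _; rewrite big_split.
Qed.

Lemma expect_dprod_ret (I X : finType) (x : I -> X) (F : {ffun I -> X} -> R) :
  expect (dprod (fun i => dret R (x i))) F = F [ffun i => x i].
Proof.
rewrite -[RHS]expect_ret; apply: eq_expect_pmf => y /=.
rewrite /prod_pmf /= /ret_pmf.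
have [->|] := eqVneq y [ffun i => x i].
  by apply: big1 => i _; rewrite ffunE eqxx.
move=> neq; apply/eqP; rewrite prodf_seq_eq0.
have [i yx] : exists i, y i != x i.
  apply/existsP; apply: contraR neq => /existsPn eqyx.
  by apply/eqP/ffunP => i; rewrite ffunE; apply/eqP; move: (eqyx i); case: eqP.
by apply/hasP; exists i; rewrite ?mem_index_enum //= (negPf yx).
Qed.

Lemma expect_dprod_map (I X Y : finType) (mu : I -> dist R X)
    (h : I -> X -> Y) (F : {ffun I -> Y} -> R) :
  expect (dprod mu) (fun w => F [ffun i => h i (w i)]) =
  expect (dprod (fun i => dmap (h i) (mu i))) F.
Proof.
by rewrite -expect_dprod_bind; apply: eq_expect => w; rewrite expect_dprod_ret.
Qed.

Definition transpose (I J X : finType) (w : {ffun I -> {ffun J -> X}}) :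
  {ffun J -> {ffun I -> X}} := [ffun j => [ffun i => w i j]].

Lemma expect_transpose (I J X : finType) (mu : I -> J -> dist R X) F :
  expect (dprod (fun i => dprod (mu i))) (F \o @transpose I J X) =
  expect (dprod (fun j => dprod (mu^~ j))) F.
Proof.
have trK (I' J' : finType) : cancel (@transpose I' J' X) (@transpose J' I' X).
  by move=> w; apply/ffunP => i; apply/ffunP => j; rewrite !ffunE.
rewrite /expect [RHS](reindex (@transpose I J X)) /=; last first.
  by exists (@transpose J I X) => w _; exact: trK.
apply: eq_bigr => w _; congr (_ * _); rewrite /prod_pmf /= /prod_pmf.
by rewrite exchange_big; do 2![apply: eq_bigr => ? _]; rewrite !ffunE.
Qed.

Lemma jensen_expR (X : finType) (mu : dist R X) (F : X -> R) :
  expR (expect mu F) <= expect mu (fun x => expR (F x)).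
Proof.
set m := expect mu F.
(* the tangent line of the exponential at the mean m *)
have tangent x : expR m * (1 + (F x - m)) <= expR (F x).
  rewrite -[X in _ <= expR X](subrKC m) expRD ler_wpM2l ?expR_ge0 //.
  exact: expR_ge1Dx.
apply: le_trans (le_expect mu tangent).
by rewrite expectZ expectD expectD !expect_cst subrr addr0 mulr1.
Qed.

End Expectation.

(** * Composition of privacy guarantees *)

Section Composition.
Variable R : realType.

Lemma one_sub_prod_le (I : Type) (r : seq I) (m : I -> R) :
  (forall i, 0 <= m i <= 1) ->
  1 - \prod_(i <- r) m i <= \sum_(i <- r) (1 - m i).
Proof.
move=> m01; elim: r => [|i r IH]; first by rewrite !big_nil subrr.
rewrite !big_cons.
have p0 : 0 <= \prod_(i <- r) m i.
  by apply: prodr_ge0 => j _; case/andP: (m01 j).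
have p1 : \prod_(i <- r) m i <= 1.
  by apply: prodr_ile1 => j _; exact: m01.
have /andP[mi0 mi1] := m01 i; nra.
Qed.

(** The overlap [minr P (e * Q)] of each factor with the inflated second law
    loses mass at most [delta].  Replacing every factor [P] by its overlap
    therefore costs at most the sum of these losses, and a product of overlaps
    is pointwise below [e ^+ #|I|] times the product of the [Q]. *)
Lemma dprod_indistinguishable (I X : finType) (P Q : I -> dist R X)
    (e delta : R) (h : {ffun I -> X} -> R) :
  0 <= e -> (forall w, 0 <= h w <= 1) ->
  (forall i S, pr (P i) S <= e * pr (Q i) S + delta) ->
  expect (dprod P) h <= e ^+ #|I| * expect (dprod Q) h + #|I|%:R * delta.
Proof.
move=> e0 h01 PQ.
pose M i x := Num.min (P i x) (e * Q i x).
have M0 i x : 0 <= M i x by rewrite le_min pmf_ge0 mulr_ge0 ?pmf_ge0.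
have MP i x : M i x <= P i x by rewrite ge_min lexx.
have MQ i x : M i x <= e * Q i x by rewrite ge_min lexx orbT.
have mass i : 1 - \sum_x M i x <= delta.
  rewrite -(pmf_sum1 (P i)) -sumrB.
  have := PQ i [set x | e * Q i x < P i x]; rewrite -lerBlDl; apply: le_trans.
  rewrite /pr mulr_sumr -sumrB [leRHS]big_mkcond; apply: ler_sum => x _.
  rewrite inE /M; case: ltP => //; by rewrite ?subrr // lexx.
have mass01 i : 0 <= \sum_x M i x <= 1.
  by rewrite sumr_ge0 //= -(pmf_sum1 (P i)) ler_sum.
have prodMP (w : {ffun I -> X}) : \prod_i M i (w i) <= dprod P w.
  by apply: ler_prod => i _; rewrite M0 MP.
have prodMQ (w : {ffun I -> X}) : \prod_i M i (w i) <= e ^+ #|I| * dprod Q w.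
  rewrite /= /prod_pmf -prodr_const -big_split /=.
  by apply: ler_prod => i _; rewrite M0 MQ.
have -> : expect (dprod P) h = \sum_(w : {ffun I -> X}) \prod_i M i (w i) * h w +
    \sum_(w : {ffun I -> X}) (dprod P w - \prod_i M i (w i)) * h w.
  by rewrite -big_split; apply: eq_bigr => w _ /=; rewrite -mulrDl subrKC.
apply: lerD.
  rewrite mulr_sumr; apply: ler_sum => w _; rewrite mulrA.
  by rewrite ler_wpM2r ?prodMQ //; case/andP: (h01 w).
apply: (@le_trans _ _ (\sum_(w : {ffun I -> X}) (dprod P w - \prod_i M i (w i)))).
  apply: ler_sum => w _; apply: ler_piMr; first by rewrite subr_ge0.
  by case/andP: (h01 w).
rewrite sumrB pmf_sum1 -bigA_distr_bigA /=.
apply: le_trans (one_sub_prod_le _ mass01) _.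
rewrite [leRHS]mulr_natl -sumr_const; exact: ler_sum.
Qed.

End Composition.

(** * Privacy of the boosted mechanism *)

Section Privacy.
Variables (R : realType) (n k T : nat).

Definition mask (G : graph n) (w : {ffun 'I_n * 'I_n -> bool}) : graph n :=
  graph_of [ffun e => adj G e.1 e.2 && w e].

(** A set of nodes off which two graphs agree also works for their subgraphs
    cut out by the same edge mask. *)
Lemma d_node_mask (G G' : graph n) w :
  (d_node (mask G w) (mask G' w) <= d_node G G')%N.
Proof.
rewrite /d_node -!minEnat -leEnat; apply: sub_bigmin => S /forallP rw.
apply/forallP => i; apply/forallP => j; apply/implyP => ijS.
have agree i' j' : (i' \notin S) && (j' \notin S) -> adj G i' j' = adj G' i' j'.
  by move=> ijS'; have /forallP/(_ j')/implyP/(_ ijS')/eqP := rw i'.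
rewrite /adj /= !mxE !ffunE /=.
by case: ltngtP => _ //; rewrite agree // andbC.
Qed.

Lemma node_DP_subsample (eps delta : R) (O : finType)
    (mech : graph n -> dist R O) :
  node_DP eps delta mech ->
  node_DP eps delta (fun G => dbind (subsample R T G) mech).
Proof.
move=> dp G G' GG' S; rewrite !pr_bind !expect_map.
rewrite -[delta](expect_cst (dprod (fun _ : 'I_n * 'I_n => dbern T%:R^-1))).
rewrite -expectZ -expectD.
apply: le_expect => w; apply: dp; apply: leq_trans GG'.
exact: d_node_mask.
Qed.

Variables (xi : R) (align : alignment_rule R n k T) (vote : vote_rule R n k T).

Definition aggregate (th : {ffun 'I_T -> labeling n k}) :
    dist R (option (labeling n k)) :=
  dbind (dselect R (candidates xi th)) (fun o =>
  if o is Some jstar then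
    dbind (align th jstar) (fun J => dmap Some (vote th J))
  else dret R None).

(** Both guarantees are about the preliminary labelings: given the input graph
    these are independent and identically distributed, and the output is a
    randomized function of them that does not look at the graph again. *)
Lemma pr_graph_boost (mech : graph n -> dist R (labeling n k)) G S :
  pr (graph_boost xi align vote mech G) S =
  expect (dprod (fun _ : 'I_T => dbind (subsample R T G) mech))
    (fun th => pr (aggregate th) S).
Proof.
rewrite pr_bind -[RHS]expect_dprod_bind; apply: eq_expect => Gs.
by rewrite pr_bind.
Qed.

Lemma node_DP_graph_boost (eps delta : R)
    (mech : graph n -> dist R (labeling n k)) :
  node_DP eps delta mech ->
  node_DP (eps * T%:R) (delta * T%:R) (graph_boost xi align vote mech).
Proof.
move=> dp G G' GG' S; rewrite !pr_graph_boost expRM_natr [delta * _]mulrC.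
rewrite -[X in _ ^+ X]card_ord -[X in X%:R * delta]card_ord.
apply: dprod_indistinguishable => [|th|i U].
- exact: expR_ge0.
- by rewrite pr_ge0 pr_le1.
- exact: node_DP_subsample.
Qed.

End Privacy.

(** * Concentration of the number of unsuccessful runs *)

Section Thinning.
Variable R : realType.

Lemma bern_pmfE (p : R) y : 0 <= p <= 1 -> dbern p y = if y then p else 1 - p.
Proof. by case/andP=> p0 p1; rewrite /= /bern_pmf min_r // max_r. Qed.

Lemma pmf_expect (X : finType) (mu : dist R X) y :
  mu y = expect mu (fun x => (x == y)%:R).
Proof.
rewrite /expect (bigD1 y) //= eqxx mulr1 big1 ?addr0 // => x.
by move=> /negPf->; rewrite mulr0.
Qed.

Lemma expect_marginal (I X : finType) (mu : I -> dist R X) i (F : X -> R) :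
  expect (dprod mu) (fun w => F (w i)) = expect (mu i) F.
Proof.
have -> : expect (mu i) F =
    \prod_j expect (mu j) (fun x => if j == i then F x else 1).
  rewrite (bigD1 i) //= eqxx big1 ?mulr1 // => j /negPf->.
  exact: expect_cst.
rewrite -expect_prod; apply: eq_expect => w.
by rewrite (bigD1 i) //= eqxx big1 ?mulr1 // => j /negPf->.
Qed.

(** The law [P] of [T] independent Bernoulli variables of parameter [b / T]
    gives mass at least [1 - b] to the zero vector, by the union bound.  Hence
    [P = (1 - b) * (point mass at 0) + b * splitting] for a probability
    [splitting], and reading off which component was drawn gives a Bernoulli
    variable [A] of parameter [b].  Each of the [T] coordinates is then,
    jointly with [A], distributed as a thinning of [A] at rate [1 / T],
    although the coordinates are independent of one another. *)
Section Splitting.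
Variables (T : nat) (T_gt0 : (0 < T)%N) (b : R) (b01 : 0 < b <= 1).

Let P := dprod (fun _ : 'I_T => dbern (b / T%:R)).
Let zero : {ffun 'I_T -> bool} := [ffun=> false].

Let bT01 : 0 <= b / T%:R <= 1.
Proof.
have [b0 b1] := andP b01.
rewrite divr_ge0 ?ler0n ?(ltW b0) //= ler_pdivrMr ?ltr0n // mul1r.
by rewrite (le_trans b1) // ler1n.
Qed.

Definition splitting_pmf h : R := (P h - (1 - b) * (h == zero)%:R) / b.

Lemma splitting_pmf_ge0 h : 0 <= splitting_pmf h.
Proof.
have [b0 b1] := andP b01.
rewrite divr_ge0 ?(ltW b0) // subr_ge0.
have [->|_] := eqVneq h zero; last by rewrite mulr0 pmf_ge0.
rewrite mulr1 /P /= /prod_pmf.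
under eq_bigr => c _ do rewrite ffunE bern_pmfE //.
have /andP[t0 t1] := bT01.
have m01 (c : 'I_T) : 0 <= 1 - b / T%:R <= 1.
  by rewrite subr_ge0 t1 gerBl.
have := one_sub_prod_le (index_enum 'I_T) m01.
under [X in _ <= X]eq_bigr => c _ do rewrite subKr.
rewrite sumr_const card_ord -[X in _ <= X]mulr_natr divfK ?pnatr_eq0 -?lt0n //.
by rewrite lerBlDr [leRHS]addrC -lerBlDr.
Qed.

Lemma splitting_pmf_sum1 : \sum_h splitting_pmf h = 1.
Proof.
have [b0 b1] := andP b01.
rewrite -mulr_suml sumrB pmf_sum1 -mulr_sumr (bigD1 zero) //= eqxx.
rewrite big1 => [|h /negPf-> //].
by rewrite addr0 mulr1 subKr divff ?gt_eqF.
Qed.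

Definition splitting := Dist splitting_pmf_ge0 splitting_pmf_sum1.

Definition split_edge (a : bool) : dist R {ffun 'I_T -> bool} :=
  if a then splitting else dret R zero.

Lemma split_bern : dbind (dbern b) split_edge =1 P.
Proof.
have [b0 b1] := andP b01.
have b01' : 0 <= b <= 1 by rewrite (ltW b0).
move=> h; rewrite -[LHS]/(\sum_a dbern b a * split_edge a h) big_bool.
rewrite !(bern_pmfE _ b01') /= /splitting_pmf /ret_pmf.
rewrite mulrC divfK ?gt_eqF //.
by rewrite subrK.
Qed.

Lemma split_marginal a c :
  dmap (fun h : {ffun 'I_T -> bool} => h c) (split_edge a) =1
  dmap (andb a) (dbern T%:R^-1).
Proof.
have [b0 b1] := andP b01.
have T0 : T%:R != 0 :> R by rewrite pnatr_eq0 -lt0n.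
have T01 : 0 <= (T%:R : R)^-1 <= 1.
  by rewrite invr_ge0 ler0n invf_le1 ?ltr0n // ler1n.
move=> y; rewrite !pmf_expect !expect_map; case: a; last first.
  by rewrite expect_ret /= ffunE expect_cst.
transitivity
  ((expect P (fun h => (h c == y)%:R) - (1 - b) * (false == y)%:R) / b).
  rewrite /expect /= /splitting_pmf.
  under eq_bigr => h _ do rewrite mulrAC mulrBl.
  rewrite -mulr_suml sumrB; congr ((_ - _) / _).
  rewrite (bigD1 zero) //= big1 => [|h /negPf->]; last by rewrite mulr0 mul0r.
  by rewrite eqxx mulr1 addr0 ffunE.
rewrite (expect_marginal _ c (fun z => (z == y)%:R)) -!pmf_expect.
rewrite !bern_pmfE //.
by case: y => /=; field; rewrite T0 gt_eqF.
Qed.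

End Splitting.

(** Let [p a] be the mean of [f] on a random thinning of [a].  Splitting every
    edge of a random [a] produces [T] graphs that are mutually independent and
    each of which is, given [a], a thinning of [a].  So [T * p a] is the
    conditional mean given [a] of a sum of [T] independent variables, and
    Jensen's inequality bounds its exponential moment by that of the sum. *)
Lemma expR_thinning_mean (E : finType) (T : nat) (b : E -> R)
    (f : {ffun E -> bool} -> R) :
  (0 < T)%N -> (forall e, 0 < b e <= 1) -> (forall w, 0 <= f w <= 1) ->
  expect (dprod (fun e => dbern (b e))) (fun a =>
    expR (T%:R * (expect (dprod (fun _ : E => dbern T%:R^-1))
                    (fun w => f [ffun e => a e && w e]) / 2))) <=
  (1 + expect (dprod (fun e => dbern (b e / T%:R))) f) ^+ T.
Proof.
move=> T0 b01 f01.
pose K (a : {ffun E -> bool}) := dprod (fun e => split_edge T0 (b01 e) (a e)).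
pose S x := \sum_(c < T) f (transpose x c) / 2.
have mean (a : {ffun E -> bool}) : T%:R * (expect (dprod (fun _ : E => dbern T%:R^-1))
    (fun w => f [ffun e => a e && w e]) / 2) = expect (K a) S.
  rewrite expect_sum mulr_natl -[X in _ *+ X]card_ord -sumr_const.
  apply: eq_bigr => c _; rewrite mulrC -expectZ.
  under [RHS]eq_expect => x do rewrite mulrC.
  rewrite (expect_dprod_map _ (fun e z => a e && z) (fun v => 2^-1 * f v)).
  under [RHS]eq_expect => x do rewrite ffunE.
  rewrite (expect_dprod_map _ (fun e (z : {ffun 'I_T -> bool}) => z c)
             (fun v => 2^-1 * f v)).
  by apply/esym/eq_expect_pmf/eq_dprod => e; exact: split_marginal.
under eq_expect => a do rewrite mean.
apply: (@le_trans _ _ (expect (dprod (fun e => dbern (b e))) (fun a =>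
  expect (K a) (fun x => expR (S x))))).
  by apply: le_expect => a; exact: jensen_expR.
rewrite (expect_dprod_bind _ (fun e => split_edge T0 (b01 e))).
rewrite (eq_expect_pmf _ (eq_dprod (fun e => split_bern T0 (b01 e)))).
under eq_expect => x do rewrite expR_sum.
rewrite (expect_transpose _ (fun y : {ffun 'I_T -> {ffun E -> bool}} =>
  \prod_(c < T) expR (f (y c) / 2))).
rewrite (expect_prod _ (fun _ v => expR (f v / 2))).
rewrite prodr_const card_ord lerXn2r ?nnegrE //.
- by apply: expect_ge0 => w; exact: expR_ge0.
- by rewrite addr_ge0 // expect_ge0 // => w; case/andP: (f01 w).
rewrite -[X in X + _](expect_cst (dprod (fun e => dbern (b e / T%:R)))).
rewrite -expectD; apply: le_expect => w; have /andP[f0 f1] := f01 w.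
(* [expR (x / 2) <= 1 / (1 - x / 2) <= 1 + x] on the unit interval *)
have := expR_ge1Dx (- (f w / 2)); rewrite expRN.
have e0 : 0 < expR (f w / 2) by exact: expR_gt0.
rewrite -(ler_pM2l e0) mulfV ?gt_eqF // => ?; nra.
Qed.

(** Markov's inequality for the moment [(3/2) ^ N] of the number [N] of
    failures among [T] independent trials. *)
Lemma half_failures (X : finType) (nu : dist R X) (Bad : {set X}) (T : nat) :
  expect (dprod (fun _ : 'I_T => nu))
    (fun th => (T <= 2 * #|[set j | th j \in Bad]|)%N%:R) <=
  expR (T%:R * (pr nu Bad / 2)) / (3 / 2) ^+ uphalf T.
Proof.
have r0 m : 0 < (3 / 2) ^+ m :> R by apply: exprn_gt0; lra.
rewrite ler_pdivlMr // mulrC -expectZ expRM_natl.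
apply: (@le_trans _ _ (expect (dprod (fun _ : 'I_T => nu))
  (fun th => \prod_j (1 + 2^-1 * (th j \in Bad)%:R)))).
  apply: le_expect => th.
  have -> : \prod_j (1 + 2^-1 * (th j \in Bad)%:R) =
      (3 / 2) ^+ #|[set j | th j \in Bad]| :> R.
    rewrite -prodr_const [RHS]big_mkcond; apply: eq_bigr => j _; rewrite inE.
    by case: (th j \in Bad) => /=; lra.
  case: leqP => [TN|_]; last by rewrite mulr0 ltW.
  rewrite mulr1 ler_weXn2l //; first by lra.
  by rewrite leq_uphalf_double -mul2n.
rewrite (expect_prod _ (fun _ x => 1 + 2^-1 * (x \in Bad)%:R)).
rewrite prodr_const card_ord lerXn2r ?nnegrE ?expR_ge0 //.
- apply: expect_ge0 => x; rewrite addr_ge0 // mulr_ge0 ?ler0n //; lra.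
- by rewrite expectD expect_cst expectZ -pr_expect mulrC expR_ge1Dx.
Qed.

End Thinning.

Section Majority.
Variables (R : realType) (n k T : nat) (B : 'M[R]_k) (theta : labeling n k).

Lemma mask_graph_of a w :
  mask (@graph_of n a) w = graph_of [ffun e => a e && w e].
Proof.
apply: val_inj; apply/matrixP => i j; rewrite !mxE !ffunE /adj /= !mxE.
by case: ltngtP.
Qed.

Lemma half_runs_fail (mech : graph n -> dist R (labeling n k))
    (Bad : {set labeling n k}) :
  (0 < T)%N -> (forall i j, 0 < B i j <= 1) ->
  pr (dbind (SBM (T%:R^-1 *: B) theta) mech) Bad <= 2 / 10 ->
  expect (SBM B theta) (fun G =>
    expect (dprod (fun _ : 'I_T => dbind (subsample R T G) mech))
      (fun th => (T <= 2 * #|[set j | th j \in Bad]|)%N%:R)) <=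
  (24 / 25) ^+ uphalf T.
Proof.
move=> T0 B01 fail.
pose b (e : 'I_n * 'I_n) := B (theta e.1) (theta e.2).
pose f w := pr (mech (graph_of w)) Bad.
have r0 m : 0 < (3 / 2) ^+ m :> R by apply: exprn_gt0; lra.
have q_le : expect (dprod (fun e => dbern (b e / T%:R))) f <= 2 / 10.
  apply: le_trans fail; rewrite pr_bind expect_map.
  rewrite le_eqVlt; apply/orP; left; apply/eqP/eq_expect_pmf/eq_dprod => e x.
  by rewrite mxE mulrC.
apply: (@le_trans _ _ (expect (SBM B theta) (fun G =>
    (3 / 2) ^- uphalf T *
    expR (T%:R * (pr (dbind (subsample R T G) mech) Bad / 2))))).
  by apply: le_expect => G; rewrite mulrC; exact: half_failures.
rewrite expectZ expect_map.
under eq_expect => a.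
  rewrite /= pr_bind expect_map.
  under eq_expect => w do rewrite /= -/(mask _ _) mask_graph_of.
  over.
have f01 w : 0 <= f w <= 1 by rewrite /f pr_ge0 pr_le1.
have b01 e : 0 < b e <= 1 by exact: B01.
rewrite ler_pdivrMl //.
apply: le_trans (expR_thinning_mean T0 b01 f01) _.
apply: (@le_trans _ _ ((6 / 5) ^+ T)).
  rewrite lerXn2r ?nnegrE //; try lra.
  by rewrite addr_ge0 // expect_ge0 // => w; case/andP: (f01 w).
rewrite -exprMn.
(* [(6 / 5) ^ 2 = (3 / 2) * (24 / 25)] *)
have -> : 3 / 2 * (24 / 25) = (6 / 5) ^+ 2 :> R by field.
rewrite -exprM ler_weXn2l //; first by lra.
by rewrite mul2n uphalf_half doubleD -[X in (X <= _)%N]odd_double_half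
  leq_add2r -addnn leq_addr.
Qed.

End Majority.

(** * Alignment and majority vote *)

Section Labelings.
Variables n k : nat.
Implicit Types (a b c : labeling n k) (s t : 'S_k).

Definition relabel s a : labeling n k := [ffun i => s (a i)].

Definition mismatch a b : nat := #|[set i | a i != b i]|.

Lemma mismatchC a b : mismatch a b = mismatch b a.
Proof. by apply: eq_card => i; rewrite !inE eq_sym. Qed.

Lemma mismatch_trans a b c : (mismatch a c <= mismatch a b + mismatch b c)%N.
Proof.
apply: leq_trans (leq_card_setU _ _); apply: subset_leq_card.
apply/subsetP => i; rewrite !inE -negb_and; apply: contra => /andP[].
by move=> /eqP-> /eqP->.
Qed.

Lemma mismatch_relabel s a b : mismatch (relabel s a) (relabel s b) = mismatch a b.
Proof.
by apply: eq_card => i; rewrite !inE !ffunE (inj_eq (@perm_inj _ s)).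
Qed.

Lemma relabelM s t a : relabel t (relabel s a) = relabel (s * t)%g a.
Proof. by apply/ffunP => i; rewrite !ffunE permM. Qed.

Lemma onehot_perm a s : onehot a *m perm_mx s = onehot (relabel s a).
Proof.
apply/matrixP => i c; rewrite !mxE (bigD1 (a i)) //= big1 => [|d da].
  by rewrite !mxE ffunE eqxx mul1r addr0.
by rewrite !mxE eq_sym (negPf da) mul0r.
Qed.

Lemma row_onehot_inj a b i : (row i (onehot a) == row i (onehot b)) = (a i == b i).
Proof.
apply/eqP/eqP => [|ab]; last by apply/rowP => c; rewrite !mxE ab.
by move/rowP/(_ (b i)); rewrite !mxE eqxx; case: eqP.
Qed.

Lemma norm0_onehot a b : norm0 (onehot a - onehot b) = (2 * mismatch a b)%N.
Proof.
rewrite /norm0 /mismatch -!sum1_card big_distrr /= muln1.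
rewrite (eq_bigl (fun e : 'I_n * 'I_k =>
  (a e.1 != b e.1) && ((e.2 == a e.1) || (e.2 == b e.1)))); last first.
  move=> [i c]; rewrite !inE !mxE /= subr_eq0 eqr_nat.
  rewrite (eq_sym (a i) c) (eq_sym (b i) c).
  have [->|ab] := eqVneq (a i) (b i); first by rewrite eqxx.
  have [->|_] := eqVneq c (a i); first by rewrite (negPf ab).
  by case: (c == b i).
rewrite -(pair_big_dep (fun i => a i != b i)
  (fun i d => (d == a i) || (d == b i)) (fun _ _ => 1%N)) /=.
rewrite [RHS](eq_bigl (fun i => a i != b i)); last by move=> i; rewrite inE.
apply: eq_bigr => i ab; rewrite sum1_card.
have <- : #|[set a i; b i]| = 2%N by rewrite cards2 ab.
by apply: eq_card => d; rewrite !inE.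
Qed.

End Labelings.

Section Losses.
Variables (R : realType) (n k : nat).
Implicit Types (a b theta : labeling n k) (s t : 'S_k).

Lemma bigmin_permP (F : 'S_k -> R) x :
  reflect (exists s, F s <= x) (\big[Num.min/F 1%g]_s F s <= x).
Proof.
apply: (iffP idP) => [le|[s Fs]]; last exact: bigmin_inf Fs.
apply/existsP; apply: contraTT le => /existsPn h.
by rewrite -ltNge; apply/bigmin_gtP; split=> [|s _]; rewrite ltNge h.
Qed.

Lemma avg_loss_leP a b x : (0 < n)%N ->
  reflect (exists s, 2 * (mismatch (relabel s a) b)%:R <= x * n%:R)
          (avg_loss R a b <= x).
Proof.
move=> n0; have n0' : 0 < n%:R :> R by rewrite ltr0n.
have E s : (2 / n%:R * \sum_(i < n) (s (a i) != b i)%:R <= x) =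
           (2 * (mismatch (relabel s a) b)%:R <= x * n%:R).
  rewrite mulrAC ler_pdivrMr // -natr_sum /mismatch -sum1_card.
  rewrite [in RHS]big_mkcond; congr (2 * _%:R <= _).
  by apply: eq_bigr => i _; rewrite inE ffunE; case: eqP.
by apply: (iffP (bigmin_permP _ _)) => -[s le]; exists s; move: le; rewrite E.
Qed.

Definition cluster_errors s a theta j : nat :=
  #|[set i in cluster theta j | s (a i) != j]|.

Lemma worst_loss_leP a theta x : (forall j, 0 < #|cluster theta j|)%N ->
  reflect (0 <= x /\ exists s, forall j,
             2 * (cluster_errors s a theta j)%:R <= x * #|cluster theta j|%:R)
          (worst_loss R a theta <= x).
Proof.
move=> c0; have E s j : (2 / #|cluster theta j|%:R *
    \sum_(i in cluster theta j) (s (a i) != j)%:R <= x) =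
    (2 * (cluster_errors s a theta j)%:R <= x * #|cluster theta j|%:R).
  rewrite mulrAC ler_pdivrMr ?ltr0n // -natr_sum; congr (2 * _%:R <= _).
  rewrite /cluster_errors -sum1_card big_mkcond [RHS]big_mkcond.
  by apply: eq_bigr => i _; rewrite !inE; do 2!case: eqP.
apply: (iffP (bigmin_permP _ _)) => [[s /bigmax_leP[x0 le]]|[x0 [s le]]].
  by split=> //; exists s => j; rewrite -E le.
by exists s; apply/bigmax_leP; split=> // j _; rewrite E.
Qed.

Lemma mismatch_clusters s a theta :
  mismatch (relabel s a) theta = (\sum_j cluster_errors s a theta j)%N.
Proof.
rewrite /mismatch -sum1_card.
rewrite (partition_big theta predT) //=; apply: eq_bigr => j _.
rewrite /cluster_errors -sum1_card; apply: eq_bigl => i.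
rewrite !inE !ffunE andbC; by case: eqP => //= ->.
Qed.

End Losses.

Section Recovery.
Variables (R : realType) (n k T : nat) (theta : labeling n k).
Hypotheses (n_gt0 : (0 < n)%N) (theta_bal : balanced theta).
Implicit Types (a b : labeling n k) (s t : 'S_k).

Lemma cluster_gt0 j : (0 < #|cluster theta j|)%N.
Proof.
rewrite lt0n; apply/eqP => c0; have := theta_bal j.
by rewrite c0 mul0n => n0; move: n_gt0; rewrite -[X in (_ < X)%N]n0.
Qed.

Lemma cluster_size j : #|cluster theta j|%:R * k%:R = n%:R :> R.
Proof. by rewrite -natrM theta_bal. Qed.

Lemma mismatch_relabelV s t a b :
  mismatch (relabel (s * t^-1)%g a) b = mismatch (relabel s a) (relabel t b).
Proof. by rewrite -(mismatch_relabel t) relabelM mulgKV. Qed.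

Lemma mismatch_cluster_bound x s a :
  (forall j, 2 * (cluster_errors s a theta j)%:R <=
             x * #|cluster theta j|%:R :> R) ->
  2 * (mismatch (relabel s a) theta)%:R <= x * n%:R :> R.
Proof.
move=> le; rewrite mismatch_clusters natr_sum mulr_sumr.
apply: (le_trans (ler_sum _ (fun j _ => le j))); rewrite -mulr_sumr -natr_sum.
have -> // : (\sum_j #|cluster theta j|)%N = n.
rewrite -[RHS]card_ord -sum1_card (partition_big theta predT) //=.
by apply: eq_bigr => j _; rewrite -sum1_card; apply: eq_bigl => i; rewrite inE.
Qed.

(** Two relabelings [s] and [t] that differ at a label send its nodes to
    different clusters.  If [s] is right on most of the cluster, then [t] is
    wrong there and mismatches about [n / k] nodes, more than the [7 / 2 * xi * n]
    allowed when [xi < 1 / (8 k)]. *)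
Lemma relabeling_unique xi s t a :
  xi < (8 * k%:R)^-1 ->
  (forall j, 2 * (cluster_errors s a theta j)%:R <=
             xi * #|cluster theta j|%:R :> R) ->
  2 * (mismatch (relabel t a) theta)%:R <= 7 * xi * n%:R :> R ->
  t = s.
Proof.
move=> xi_lt s_good t_good; apply/permP => x; apply/eqP; apply: contraT => tsx.
set j := s x.
have size_le :
    (#|cluster theta j| <= cluster_errors s a theta j + mismatch (relabel t a) theta)%N.
  apply: leq_trans (leq_card_setU _ _); apply: subset_leq_card.
  apply/subsetP => i; rewrite !inE ffunE => /eqP->; rewrite eqxx /=.
  case: (s (a i) =P j) => //= /perm_inj->.
  exact: tsx.
have m0 : 0 < #|cluster theta j|%:R :> R by rewrite ltr0n cluster_gt0.
have k1 : 1 <= k%:R :> R by rewrite ler1n (leq_ltn_trans _ (ltn_ord x)).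
move: size_le (s_good j) t_good; rewrite -(ler_nat R) natrD -(cluster_size j).
set m := _%:R in m0 *; set E := (cluster_errors _ _ _ _)%:R.
set M := (mismatch _ _)%:R => mEM sE tM.
have E0 : 0 <= E by exact: ler0n.
have xi0 : 0 <= xi.
  by rewrite -(pmulr_lge0 _ m0); apply: le_trans sE; rewrite mulr_ge0.
have k0 : 0 < k%:R :> R by apply: lt_le_trans k1.
have xik : xi * (8 * k%:R) < 1.
  by rewrite -ltr_pdivlMr ?mul1r // mulr_gt0.
have : 2 * m <= m * (xi * (8 * k%:R)).
  apply: (@le_trans _ _ (xi * m + 7 * xi * (m * k%:R))); first by lra.
  have -> : m * (xi * (8 * k%:R)) = xi * m * k%:R + 7 * xi * (m * k%:R) by ring.
  by rewrite lerD2r ler_peMr // mulr_ge0 // ltW.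
have : m * (xi * (8 * k%:R)) < m by rewrite gtr_pMr.
by move=> ? ?; lra.
Qed.

Variables (xi : R) (th : {ffun 'I_T -> labeling n k}).

Let good := [set j | worst_loss R (th j) theta <= xi].

Hypotheses (xi_lt : xi < (8 * k%:R)^-1) (majority : (T < 2 * #|good|)%N).

Let good_relabel j : j \in good -> exists s, forall c,
  2 * (cluster_errors s (th j) theta c)%:R <= xi * #|cluster theta c|%:R :> R.
Proof. by rewrite inE => /(worst_loss_leP _ _ cluster_gt0)[]. Qed.

Lemma candidates_neq0 : candidates xi th != set0.
Proof.
have [i0 i0good] : exists i, i \in good.
  by apply/card_gt0P; move: majority; case: #|good| => //; rewrite muln0.
apply/set0Pn; exists i0; rewrite inE.
apply: (@le_trans _ _ #|good|%:R).
  by rewrite ler_pdivrMr // natr1 -natrM ler_nat mulnC.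
rewrite -sum1_card natr_sum big_mkcond; apply: ler_sum => j _.
case: ifP => // jgood.
have [s s_good] := good_relabel i0good; have [t t_good] := good_relabel jgood.
have -> // : avg_loss R (th i0) (th j) <= 2 * xi.
apply/avg_loss_leP => //; exists (s * t^-1)%g; rewrite mismatch_relabelV.
have := mismatch_trans (relabel s (th i0)) theta (relabel t (th j)).
rewrite [X in (_ <= _ + X)%N]mismatchC -(ler_nat R) natrD => le.
have := mismatch_cluster_bound s_good; have := mismatch_cluster_bound t_good.
by move=> ? ?; lra.
Qed.

(** The selected run [jstar] is close to a majority of the runs, hence to a
    good one, hence to [theta] up to a relabeling [u].  Aligning a good run with
    [th jstar] is then the same as aligning it with [theta], up to the common
    relabeling [u].  A node on which all good runs are right is won by the
    majority, so the errors of the vote are covered by those of the good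
    runs.

    Counting twice the mismatches, in units of [xi * n]: a good run is within
    1 of [theta], [th jstar] is within 2 + 1 = 3 of it, a good run is within 4
    of [th jstar] for the best alignment, and so within 4 + 3 = 7 of [theta]
    after the alignment [J j]. *)
Lemma vote_worst_loss jstar (J : {ffun 'I_T -> 'S_k}) l :
  jstar \in candidates xi th ->
  (forall (j : 'I_T) s,
    (norm0 (aligned th J j - onehot (th jstar)) <=
     norm0 (onehot (th j) *m perm_mx s - onehot (th jstar)))%N) ->
  (forall i (v : 'rV[int]_k),
    (#|[set j | row i (aligned th J j) == v]| <=
     #|[set j | row i (aligned th J j) == row i (onehot l)]|)%N) ->
  worst_loss R l theta <= xi * T%:R.
Proof.
rewrite inE => near_maj J_min l_mode.
pose near := [set j | avg_loss R (th jstar) (th j) <= 2 * xi].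
have near_card : (T < 2 * #|near|)%N.
  have nearE : \sum_(j < T) (avg_loss R (th jstar) (th j) <= 2 * xi)%R%:R =
      #|near|%:R :> R.
    rewrite -sum1_card natr_sum [RHS]big_mkcond.
    by apply: eq_bigr => j _; rewrite inE; case: ifP.
  by move: near_maj; rewrite nearE -(ltr_nat R) natrM => ?; lra.
have [j0] : exists j, j \in good :&: near.
  apply/card_gt0P; have := cardsUI good near; have := max_card (good :|: near).
  rewrite card_ord => ? ?; lia.
rewrite !inE => /andP[j0good j0near].
have xi0 : 0 <= xi by case/(worst_loss_leP _ _ cluster_gt0): (j0good).
have {j0good} [s0 s0_good] : exists s, forall c,
    2 * (cluster_errors s (th j0) theta c)%:R <= xi * #|cluster theta c|%:R :> R.
  by apply: good_relabel; rewrite inE.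
have {j0near} [v v_near] := avg_loss_leP _ _ _ n_gt0 j0near.
pose u := (v * s0)%g.
have u_le : 2 * (mismatch (relabel u (th jstar)) theta)%:R <= 3 * xi * n%:R :> R.
  rewrite -relabelM.
  have := mismatch_trans (relabel s0 (relabel v (th jstar))) (relabel s0 (th j0)) theta.
  rewrite mismatch_relabel -(ler_nat R) natrD => ?.
  by have := mismatch_cluster_bound s0_good; lra.
have J_good j s : (forall c, 2 * (cluster_errors s (th j) theta c)%:R <=
    xi * #|cluster theta c|%:R :> R) -> (J j * u)%g = s.
  move=> s_good; apply: (relabeling_unique xi_lt s_good).
  have := J_min j (s * u^-1)%g.
  rewrite /aligned !onehot_perm !norm0_onehot leq_pmul2l // mismatch_relabelV.
  rewrite -(mismatch_relabel u) relabelM.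
  have := mismatch_trans (relabel s (th j)) theta (relabel u (th jstar)).
  rewrite [X in (_ <= _ + X)%N]mismatchC.
  have := mismatch_trans (relabel (J j * u) (th j)) (relabel u (th jstar)) theta.
  rewrite -!(ler_nat R) !natrD => ? ? ?.
  by have := mismatch_cluster_bound s_good; lra.
apply/worst_loss_leP; first exact: cluster_gt0.
split; first by rewrite mulr_ge0.
exists u => c.
have cover : (cluster_errors u l theta c <=
    \sum_(j in good) cluster_errors (J j * u) (th j) theta c)%N.
  rewrite /cluster_errors -sum1_card.
  under [X in (_ <= X)%N]eq_bigr => j _ do rewrite -sum1_card big_mkcond.
  rewrite exchange_big [X in (X <= _)%N]big_mkcond; apply: leq_sum => i _.
  case: ifP => //; rewrite !inE => /andP[ic wrong].
  suff /existsP[j /andP[jgood jwrong]] : [exists j, (j \in good) &&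
      (i \in [set i in cluster theta c | (J j * u)%g (th j i) != c])].
    by rewrite (bigD1 j) //= jwrong.
  (* otherwise all good runs vote for one label, different from [l i] *)
  apply: contraT => /existsPn allright.
  pose w : labeling n k := [ffun=> (u^-1)%g c].
  have goodvote : good \subset [set j | row i (aligned th J j) == row i (onehot w)].
    apply/subsetP => j jgood; move: (allright j).
    rewrite jgood /= !inE ic /= negbK permM => /eqP ujc.
    by rewrite /aligned onehot_perm row_onehot_inj !ffunE -ujc permK.
  have disj : [disjoint [set j | row i (aligned th J j) == row i (onehot w)] &
                        [set j | row i (aligned th J j) == row i (onehot l)]].
    rewrite -setI_eq0; apply/eqP/setP => j; rewrite !inE.
    apply/negP => /andP[/eqP->]; rewrite row_onehot_inj ffunE => /eqP uc.
    by move: wrong; rewrite -uc permKV eqxx.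
  have := l_mode i (row i (onehot w)); have := subset_leq_card goodvote.
  have := max_card ([set j | row i (aligned th J j) == row i (onehot w)] :|:
                    [set j | row i (aligned th J j) == row i (onehot l)]).
  rewrite card_ord; move: disj; rewrite -leq_card_setU => /eqP->.
  by move=> ? ? ?; lia.
move: cover; rewrite -(ler_nat R) natr_sum => cover.
apply: (@le_trans _ _ (\sum_(j in good) xi * #|cluster theta c|%:R)).
  apply: (@le_trans _ _ (\sum_(j in good)
      2 * (cluster_errors (J j * u) (th j) theta c)%:R)).
    by rewrite -mulr_sumr ler_pM2l.
  apply: ler_sum => j jgood; have [s s_good] := good_relabel jgood.
  by rewrite (J_good _ _ s_good).
rewrite sumr_const -[leLHS]mulr_natr -!mulrA ler_wpM2l // mulrC.
by rewrite ler_wpM2r // ler_nat -[X in (_ <= X)%N]card_ord max_card.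
Qed.

End Recovery.

(** * Utility of the boosted mechanism *)

Section Utility.
Variable R : realType.

Lemma aggregate_success n k T (xi : R) (theta : labeling n k)
    (align : alignment_rule R n k T) (vote : vote_rule R n k T)
    (th : {ffun 'I_T -> labeling n k}) :
  (0 < n)%N -> balanced theta -> valid_alignment align -> valid_vote vote ->
  xi < (8 * k%:R)^-1 ->
  (T < 2 * #|[set j | (worst_loss R (th j) theta <= xi)%R]|)%N ->
  pr (aggregate xi align vote th)
    [set o | if o is Some l then xi * T%:R < worst_loss R l theta else true]
  = 0.
Proof.
move=> n0 bal alignP voteP xi_lt maj; apply/le_anti; rewrite pr_ge0 andbT.
rewrite pr_bind -[leRHS](expect_cst (dselect R (candidates xi th)) 0).
apply: le_expect_supp => -[jstar|] /=; last first.
  by rewrite (negPf (candidates_neq0 n0 bal maj)) eqxx.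
rewrite mulf_eq0 negb_or pnatr_eq0 eqb0 negbK => /andP[jcand _].
rewrite pr_bind -[leRHS](expect_cst (align th jstar) 0).
apply: le_expect_supp => J /alignP J_min.
rewrite pr_expect expect_map -[leRHS](expect_cst (vote th J) 0).
apply: le_expect_supp => l /voteP l_mode; rewrite /= inE ltNge.
by rewrite (vote_worst_loss n0 bal xi_lt maj jcand J_min l_mode).
Qed.

Lemma graph_boost_failure n k T (xi : R) (B : 'M[R]_k) (theta : labeling n k)
    (align : alignment_rule R n k T) (vote : vote_rule R n k T)
    (mech : graph n -> dist R (labeling n k)) :
  (0 < n)%N -> (0 < T)%N -> connectivity B -> balanced theta ->
  valid_alignment align -> valid_vote vote -> xi < (8 * k%:R)^-1 ->
  pr (dbind (SBM (T%:R^-1 *: B) theta) mech)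
     [set l | xi < worst_loss R l theta] <= 2 / 10 ->
  pr (dbind (SBM B theta) (graph_boost xi align vote mech))
     [set o | if o is Some l then xi * T%:R < worst_loss R l theta else true]
  <= (24 / 25) ^+ uphalf T.
Proof.
move=> n0 T0 [B01 _ _] bal alignP voteP xi_lt fail.
apply: le_trans (half_runs_fail T0 B01 fail).
rewrite pr_bind; apply: le_expect => G; rewrite pr_graph_boost.
apply: le_expect => th; case: leqP => [_|bad_lt]; first exact: pr_le1.
rewrite aggregate_success //.
set bad := [set j | th j \in _] in bad_lt *.
have <- : ~: bad = [set j | worst_loss R (th j) theta <= xi].
  by apply/setP => j; rewrite !inE -leNgt.
by move: (cardsC bad) bad_lt; rewrite card_ord; move: #|bad| #|_| => p q; lia.
Qed.

(** The failure probability decays geometrically in [T], so its bound by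
    [1 / ln n] holds eventually however small the constant in front of [ln n]
    in the lower bound on [T] is. *)
Lemma geometric_le_inv_ln (T : nat -> nat) :
  asymp (fun n : nat => (T n)%:R : R) (fun n : nat => ln n%:R) ->
  exists N : nat, forall n : nat, (N <= n)%N ->
    (0 < n)%N /\ (24 / 25) ^+ uphalf (T n) <= 1 / ln n%:R :> R.
Proof.
move=> [c1 [c2 [c1_gt0 _ [N0 bounds]]]].
(* [ln n >= K] is what makes [(c1 * ln n / 100) ^ 2 >= ln n] *)
pose K := 10000 / c1 ^+ 2.
have K0 : 0 < K by rewrite divr_gt0 ?exprn_gt0.
exists (maxn N0 (Num.bound (expR K))) => n; rewrite geq_max => /andP[N0n Kn].
have exp_n : expR K < n%:R.
  by apply: lt_le_trans (archi_boundP (expR_ge0 K)) _; rewrite ler_nat.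
have n0 : 0 < n%:R :> R by apply: lt_trans exp_n; exact: expR_gt0.
split; first by rewrite -(ltr0n R).
set L := ln n%:R.
have KL : K <= L by rewrite -[K]expRK ler_ln ?posrE ?expR_gt0 // ltW.
have L0 : 0 < L by apply: lt_le_trans KL.
have [TL _] := bounds n N0n.
set u := uphalf (T n).
have Tu : (T n)%:R <= 2 * u%:R :> R.
  by rewrite -natrM ler_nat mul2n -leq_uphalf_double.
have root_le : 24 / 25 <= expR (- (1 / 25)) :> R.
  by apply: le_trans (expR_ge1Dx _); lra.
rewrite ler_pdivlMr // -ler_pdivlMl ?exprn_gt0 //; last by lra.
rewrite mulr1.
apply: (@le_trans _ _ (expR (u%:R / 50) ^+ 2)); last first.
  rewrite -expRM_natl.
  have -> : 2%:R * (u%:R / 50) = - (u%:R * - (1 / 25)) :> R by field.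
  rewrite expRN expRM_natl lef_pV2 ?posrE ?exprn_gt0 ?expR_gt0 //; last by lra.
  by rewrite lerXn2r ?nnegrE ?expR_ge0 //; lra.
apply: (@le_trans _ _ ((c1 * L / 100) ^+ 2)).
  have -> : (c1 * L / 100) ^+ 2 = L * (L / K) by rewrite /K; field; lra.
  by rewrite ler_peMr ?(ltW L0) // ler_pdivlMr // mul1r.
have cL0 : 0 <= c1 * L / 100 by rewrite divr_ge0 ?mulr_ge0 ?(ltW c1_gt0) ?(ltW L0).
rewrite lerXn2r ?nnegrE ?expR_ge0 //.
by apply: le_trans (expR_ge1Dx _); rewrite -/L in TL; lra.
Qed.

End Utility.

Theorem proposition1 (R : realType) :
  exists c : R, 0 < c /\
  forall T : nat -> nat,
  (forall n : nat, odd (T n)) ->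
  asymp (fun n : nat => (T n)%:R : R) (fun n : nat => ln n%:R) ->
  exists N : nat, forall n : nat, (N <= n)%N ->
  forall (k : nat) (eps delta xi : R) (B : 'M[R]_k) (theta : labeling n k)
    (mech : graph n -> dist R (labeling n k))
    (align : alignment_rule R n k (T n)) (vote : vote_rule R n k (T n)),
  connectivity B ->
  balanced theta ->
  valid_alignment align ->
  valid_vote vote ->
  xi < (8 * k%:R)^-1 ->
  node_DP eps delta mech ->
  pr (dbind (SBM ((T n)%:R^-1 *: B) theta) mech)
     [set l | xi < worst_loss R l theta] <= 2 / 10 ->
  node_DP (eps * (T n)%:R) (delta * (T n)%:R)
    (graph_boost xi align vote mech) /\
  pr (dbind (SBM B theta) (graph_boost xi align vote mech))
     [set o | if o is Some l then xi * (T n)%:R < worst_loss R l theta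
              else true] <= c / ln n%:R.
Proof.
exists 1; split=> // T T_odd T_ln.
have [N HN] := geometric_le_inv_ln T_ln.
exists N => n /HN[n0 decay] k eps delta xi B theta mech align vote.
move=> conn bal alignP voteP xi_lt dp fail.
split; first exact: node_DP_graph_boost.
apply: le_trans decay; apply: graph_boost_failure => //.
by case: (T n) (T_odd n).
Qed.
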